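(* Let $m$ be an odd positive integer and $\delta\in\mathbb{F}_{2^{2m}}$. Then $$f(x)=x+\left(\mathrm{Tr}_m^{2m}(x)^{(2^m+1)/3}+\delta\right)^{2^{m-1}+1}$$ is a permutation polynomial of $\mathbb{F}_{2^{2m}}$ and its compositional inverse over $\mathbb{F}_{2^{2m}}$ is $$f^{-1}(x)=x+\left(\left(\mathrm{Tr}_m^{2m}(x)^2+\delta^3+\delta^{3\cdot2^m}\right)^{(2^{m+1}-1)/3}+\delta^{2^m}\right)^{2^{m-1}+1}.$$
   Context: $\mathrm{Tr}_m^{2m}(x)=x+x^{2^m}$ is the trace map from $\mathbb{F}_{2^{2m}}$ to $\mathbb{F}_{2^m}$. The compositional inverse of a permutation polynomial $F$ of a finite field $\mathbb{F}$ is the unique polynomial map $F^{-1}$ with $F(F^{-1}(x))=F^{-1}(F(x))=x$ for all $x\in\mathbb{F}$. *)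

(* Defs.v *)
From mathcomp Require Import all_boot all_order all_algebra all_field.
Set Implicit Arguments.
Unset Strict Implicit.
Unset Printing Implicit Defensive.
Import GRing.Theory.
Local Open Scope ring_scope.

(* The trace $x + x^{2^m}$ of the field with $2^{2m}$ elements onto its subfield
   with $2^m$ elements. It is stated over any ring so that it can be taken both
   of field elements and of the polynomial ['X]. *)
Definition Trm (R : nzRingType) (m : nat) (x : R) : R := x + x ^+ (2 ^ m)%N.

Definition permutation_polynomial (F : finFieldType) (p : {poly F}) : Prop :=
  bijective (fun x : F => p.[x]).

(* An inverse of the map induced on [F] by [p]. It is unique as a map, not as a
   formal polynomial (which is only determined modulo ['X^#|F| - 'X]). *)
Definition compositional_inverse (F : finFieldType) (p q : {poly F}) : Prop :=
  forall x : F, p.[q.[x]] = x /\ q.[p.[x]] = x.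

Lemma compositional_inverse_uniq (F : finFieldType) (p q r : {poly F}) :
  compositional_inverse p q -> compositional_inverse p r ->
  forall x : F, q.[x] = r.[x].
Proof. by move=> pq pr x; rewrite -{1}(pr x).1 (pq _).2. Qed.

(* Main.v *)
Require Import Defs.
From mathcomp Require Import all_boot all_order all_algebra all_field.
From mathcomp Require Import ring zify.
Import GRing.Theory.
Local Open Scope ring_scope.

(** Write [q = 2^m], [z' = z^q], [T = x + x'] and [u = T^((q+1)/3)]. As [T] lies
    in the field with [q] elements, [u^3 = T^(q+1) = T^2]. Squaring turns the
    exponent [q/2+1] into [q+2], and with [s = delta + delta'] one finds
    [Tr (f x)^2 + delta^3 + delta'^3 = (u + s)^3]. Since [3 * ((2q-1)/3)] is
    [1] modulo [q-1], the power [(2q-1)/3] extracts the cube root [u + s], and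
    [u + s + delta' = u + delta], so the correction added by the inverse is the
    one added by [f], and the two cancel. *)

(** For odd [m], [2 ^ m] is twice a power of 4, and 4 is 1 modulo 3. *)
Lemma dvdn3_expn2_odd (m : nat) : odd m -> (3 %| 2 ^ m + 1)%N.
Proof.
move=> m_odd; rewrite -(odd_double_half m) m_odd expnD -mul2n expnM.
by rewrite /dvdn -modnDml -modnMmr -modnXm exp1n.
Qed.

Lemma pchar2_cube_identity (R : comNzRingType) (u d e : R) :
  2 \in [pchar R] ->
  u ^+ 3 + (u + d) ^+ 2 * (u + e) + (u + e) ^+ 2 * (u + d) + d ^+ 3 + e ^+ 3
  = (u + d + e) ^+ 3.
Proof.
move=> pcharR2; apply/subr0_eq.
(* Over the integers the two sides differ by an even polynomial; the bracket is half of that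
   difference. *)
transitivity (2%:R * (u ^+ 3 - u * (d + e) ^+ 2 + u * (d * e)
                      - d * e * (d + e))); first by ring.
by rewrite pcharf0 ?mul0r.
Qed.

Section QuadraticExtension.

Variables (F : finFieldType) (m : nat).
Hypothesis cardF : #|F| = (2 ^ (2 * m))%N.
Hypothesis m_gt0 : (0 < m)%N.

Let q := (2 ^ m)%N.

Lemma pchar2_card : 2 \in [pchar F].
Proof. exact: card_finPcharP cardF _. Qed.

Lemma exprDq (x y : F) : (x + y) ^+ q = x ^+ q + y ^+ q.
Proof. by rewrite exprDn_pchar // pnatX pnatE // pchar2_card. Qed.

Lemma sqrrD2 (x y : F) : (x + y) ^+ 2 = x ^+ 2 + y ^+ 2.
Proof. by rewrite exprDn_pchar // pnatE // pchar2_card. Qed.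

Lemma exprqq (x : F) : (x ^+ q) ^+ q = x.
Proof. by rewrite -exprM -expnD addnn -mul2n -cardF expf_card. Qed.

Lemma Trm_exprq (x : F) : Trm m x ^+ q = Trm m x.
Proof. by rewrite /Trm exprDq exprqq addrC. Qed.

Lemma Trm_shift_sqr (x a : F) :
  Trm m (x + a ^+ (2 ^ (m - 1) + 1)) ^+ 2
  = Trm m x ^+ 2 + a ^+ 2 * a ^+ q + (a ^+ q) ^+ 2 * a.
Proof.
have sqr_b : (a ^+ (2 ^ (m - 1) + 1)) ^+ 2 = a ^+ 2 * a ^+ q.
  by rewrite -exprM mulnDl mul1n -expnSr subn1 prednK // addnC exprD.
rewrite /Trm exprDq addrACA sqrrD2 -addrA; congr (_ + _).
by rewrite sqrrD2 [(_ ^+ (2 ^ m)) ^+ 2]exprAC sqr_b exprMn exprqq exprAC.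
Qed.

Hypothesis m_odd : odd m.

Lemma cube_root_Trm_sqr (t : F) :
  t ^+ q = t -> (t ^+ ((q + 1) %/ 3)) ^+ 3 = t ^+ 2.
Proof.
by move=> tq; rewrite -exprM divnK ?dvdn3_expn2_odd // exprD tq expr1 expr2.
Qed.

Lemma cube_rootK (v : F) :
  v ^+ q = v -> (v ^+ 3) ^+ ((2 ^ (m + 1) - 1) %/ 3) = v.
Proof.
move=> vq; have := dvdn3_expn2_odd _ m_odd; have := expn_gt0 2 m.
rewrite -exprM [(m + 1)%N]addn1 expnS -/q => q_gt0 dvd3q.
(* Divisibility is exact, as [2 * q - 1 = 2 * (q + 1) - 3]. Splitting off [v ^+ q = v] leaves
   [v * v ^+ (q - 1) = v ^+ q], so [v = 0] needs no separate case. *)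
have -> : (3 * ((2 * q - 1) %/ 3) = q + (q - 1))%N by lia.
by rewrite exprD vq -exprS subn1 prednK.
Qed.

End QuadraticExtension.

Theorem theorem7 (F : finFieldType) (m : nat) (delta : F)
    (hm : odd m) (hF : #|F| = (2 ^ (2 * m))%N) :
  let f : {poly F} :=
    'X + (Trm m 'X ^+ ((2 ^ m + 1) %/ 3)%N + delta%:P)
           ^+ (2 ^ (m - 1) + 1)%N in
  let finv : {poly F} :=
    'X + ((Trm m 'X ^+ 2 + (delta ^+ 3)%:P + (delta ^+ (3 * 2 ^ m)%N)%:P)
             ^+ ((2 ^ (m + 1) - 1) %/ 3)%N
           + (delta ^+ (2 ^ m)%N)%:P)
           ^+ (2 ^ (m - 1) + 1)%N in
  permutation_polynomial f /\ compositional_inverse f finv.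
Proof.
move=> f finv.
have m_gt0 : (0 < m)%N by case: (m) hm.
have pcharF2 := pchar2_card _ _ hF.
have fE x : f.[x] = x + (Trm m x ^+ ((2 ^ m + 1) %/ 3) + delta)
                          ^+ (2 ^ (m - 1) + 1).
  by rewrite /f /Trm !(hornerE, horner_exp).
have finvE x : finv.[x] =
    x + ((Trm m x ^+ 2 + delta ^+ 3 + delta ^+ (3 * 2 ^ m))
           ^+ ((2 ^ (m + 1) - 1) %/ 3) + delta ^+ (2 ^ m)) ^+ (2 ^ (m - 1) + 1).
  by rewrite /finv /Trm !(hornerE, horner_exp).
have fK : cancel (horner f) (horner finv).
  move=> x; rewrite finvE fE.
  set u := Trm m x ^+ _; set b := (u + delta) ^+ _.
  have uq : u ^+ (2 ^ m) = u by rewrite /u exprAC Trm_exprq.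
  have u3 : u ^+ 3 = Trm m x ^+ 2 by rewrite cube_root_Trm_sqr ?Trm_exprq.
  (* Since [u] is fixed by the [q]-th power, the conjugate of [u + delta] is [u + delta ^+ q]: this
     is the cube identity with [d = delta] and [e = delta ^+ q]. *)
  rewrite Trm_shift_sqr // -u3 exprDq // uq (mulnC 3) exprM.
  rewrite pchar2_cube_identity // cube_rootK //; last first.
    (* Conjugation fixes [u] and swaps [delta] with [delta ^+ q], so it fixes their sum. *)
    by rewrite !exprDq // uq exprqq // -!addrA [delta + _]addrC.
  by rewrite -[_ + _ + delta ^+ _]addrA addrr_pchar2 // addr0
             -addrA addrr_pchar2 // addr0.
(* As [F] is finite, a left inverse makes [f] bijective and is also a right inverse. *)
split=> [|x]; first exact: injF_bij (can_inj fK).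
by split; [apply: (canF_sym fK) | apply: fK].
Qed.
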